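(* Let $M$ be a vector space and $T_M\in\mathrm{End}_{\mathbf{k}}(M)$; then $(M,T_M)$ is a Rota-Baxter algebra of weight $\lambda$ with trivial multiplication. Let $(A,T)$ be a Rota-Baxter algebra of weight $\lambda$. Then two isomorphic abelian extensions of $(A,T)$ by $(M,T_M)$ give rise to the same cohomology class in $\mathrm{H}^2_{\mathrm{RBA}_\lambda}(A,M)$ (where $M$ carries the Rota-Baxter bimodule structure induced by the extensions).
   Context: $\mathbf{k}$ is a field of characteristic $0$, $\lambda\in\mathbf{k}$; everything is over $\mathbf{k}$. A Rota-Baxter algebra of weight $\lambda$ is an associative algebra $A$ with a linear map $T:A\to A$ such that $T(a)T(b)=T(aT(b)+T(a)b+\lambda ab)$. A Rota-Baxter bimodule over $(A,T)$ is an $A$-bimodule $M$ with a linear map $T_M:M\to M$ such that $T(a)T_M(m)=T_M(aT_M(m)+T(a)m+\lambda am)$ and $T_M(m)T(a)=T_M(mT(a)+T_M(m)a+\lambda ma)$. Write $a_{i,j}=a_i\otimes\cdots\otimes a_j$ (empty if $i>j$). **Abelian extensions.** An abelian extension of $(A,T)$ by $(M,T_M)$ (with $uv=0$ for all $u,v\in M$) is a short exact sequence of morphisms of Rota-Baxter algebras $0\to(M,T_M)\xrightarrow{i}(\hat A,\hat T)\xrightarrow{p}(A,T)\to0$; $M$ is identified with $i(M)$. Two abelian extensions $(\hat A_1,\hat T_1)$, $(\hat A_2,\hat T_2)$ are isomorphic if there is an isomorphism of Rota-Baxter algebras $\zeta:\hat A_1\to\hat A_2$ inducing the identity on $M$ and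 on $A$. A section is a linear map $s:A\to\hat A$ with $p\circ s=\mathrm{Id}_A$. Given a section, $am:=s(a)m$, $ma:=ms(a)$ make $(M,T_M)$ a Rota-Baxter bimodule over $(A,T)$, independent of $s$, and $\psi(a\otimes b)=s(a)s(b)-s(ab)$, $\chi(a)=\hat T(s(a))-s(T(a))$ define a $2$-cocycle $(\psi,\chi)\in\mathrm{C}^2_{\mathrm{RBA}_\lambda}(A,M)$ whose class, independent of $s$, is the cohomology class the extension gives rise to. **Cochain complex.** Let $\mathrm{C}^n_{\mathrm{Alg}}(A,M)=\mathrm{C}^n_{\mathrm{RBO}_\lambda}(A,M)=\mathrm{Hom}(A^{\otimes n},M)$, $n\geqslant0$. - $\delta^n(f)(a_{1,n+1})=(-1)^{n+1}a_1f(a_{2,n+1})+\sum_{i=1}^n(-1)^{n-i+1}f(a_{1,i-1}\otimes a_ia_{i+1}\otimes a_{i+2,n+1})+f(a_{1,n})a_{n+1}$. - With $a\star b=aT(b)+T(a)b+\lambda ab$, $a\rhd m=T(a)m-T_M(am)$, $m\lhd a=mT(a)-T_M(ma)$: $\partial^n(f)(a_{1,n+1})=(-1)^{n+1}a_1\rhd f(a_{2,n+1})+\sum_{i=1}^n(-1)^{n-i+1}f(a_{1,i-1}\otimes a_i\star a_{i+1}\otimes a_{i+2,n+1})+f(a_{1,n})\lhd a_{n+1}$. - $\Phi^0=\mathrm{Id}$ and for $n\geqslant1$: $\Phi^n(f)(a_{1,n})=f(T(a_1)\otimes\cdots\otimes T(a_n))-\sum_{k=0}^{n-1}\lambda^{n-k-1}\sum_{1\leqslant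 i_1<\cdots<i_k\leqslant n}T_M\circ f(a_{1,i_1-1}\otimes T(a_{i_1})\otimes a_{i_1+1,i_2-1}\otimes T(a_{i_2})\otimes\cdots\otimes T(a_{i_k})\otimes a_{i_k+1,n})$. - $\mathrm{C}^0_{\mathrm{RBA}_\lambda}(A,M)=\mathrm{C}^0_{\mathrm{Alg}}(A,M)$, $\mathrm{C}^n_{\mathrm{RBA}_\lambda}(A,M)=\mathrm{C}^n_{\mathrm{Alg}}(A,M)\oplus\mathrm{C}^{n-1}_{\mathrm{RBO}_\lambda}(A,M)$ for $n\geqslant1$, with $d^n(f,g)=(\delta^n(f),-\partial^{n-1}(g)-\Phi^n(f))$. Its cohomology is $\mathrm{H}^\bullet_{\mathrm{RBA}_\lambda}(A,M)$. *)

(* Defs.v *)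
From HB Require Import structures.
From mathcomp Require Import all_boot all_order all_algebra.
From mathcomp Require Import boolp classical_sets functions.
Set Implicit Arguments.
Unset Strict Implicit.
Unset Printing Implicit Defensive.
Import GRing.Theory.
Local Open Scope ring_scope.

(* MathComp's algebras are unital; the algebras here need not be, since a
   vector space with zero product has to be one of them. *)
Record rbAlgebra (k : fieldType) (lambda : k) := RBAlgebra {
  rb_car :> lmodType k;
  rb_mul : {bilinear rb_car -> rb_car -> rb_car};
  rb_op : {linear rb_car -> rb_car};
  rb_mulA : associative rb_mul;
  rb_opM : forall a b,
    rb_mul (rb_op a) (rb_op b) =
    rb_op (rb_mul a (rb_op b) + rb_mul (rb_op a) b + lambda *: rb_mul a b) }.
Arguments rb_mul {k lambda r}.
Arguments rb_op {k lambda r}.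

Record rbHom (k : fieldType) (lambda : k) (A B : rbAlgebra lambda) := RBHom {
  rb_hom :> {linear A -> B};
  rb_homM : forall a b, rb_hom (rb_mul a b) = rb_mul (rb_hom a) (rb_hom b);
  rb_homT : forall a, rb_hom (rb_op a) = rb_op (rb_hom a) }.

Section TrivialProduct.
Variables (k : fieldType) (lambda : k) (M : lmodType k) (TM : {linear M -> M}).

Definition zero_mul (u v : M) : M := 0.

Fact zero_mul_bilinear : bilinear_for *:%R *:%R zero_mul.
Proof. by split=> u a x y; rewrite /zero_mul /= scaler0 addr0. Qed.
HB.instance Definition _ :=
  bilinear_isBilinear.Build k M M M *:%R *:%R zero_mul zero_mul_bilinear.

Fact zero_mulA : associative zero_mul. Proof. by []. Qed.

Fact zero_mul_rb a b :
  zero_mul (TM a) (TM b) =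
  TM (zero_mul a (TM b) + zero_mul (TM a) b + lambda *: zero_mul a b).
Proof. by rewrite /zero_mul scaler0 !addr0 linear0. Qed.

Definition trivial_rb : rbAlgebra lambda :=
  @RBAlgebra k lambda M zero_mul TM zero_mulA zero_mul_rb.
End TrivialProduct.

Record rbBimodule (k : fieldType) (lambda : k) (A : rbAlgebra lambda)
    (M : lmodType k) (TM : {linear M -> M}) := RBBimodule {
  lact : {bilinear A -> M -> M};
  ract : {bilinear M -> A -> M};
  lactA : forall a b m, lact (rb_mul a b) m = lact a (lact b m);
  ractA : forall m a b, ract m (rb_mul a b) = ract (ract m a) b;
  lractA : forall a m b, ract (lact a m) b = lact a (ract m b);
  lactT : forall a m,
    lact (rb_op a) (TM m) =
    TM (lact a (TM m) + lact (rb_op a) m + lambda *: lact a m);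
  ractT : forall m a,
    ract (TM m) (rb_op a) =
    TM (ract m (rb_op a) + ract (TM m) a + lambda *: ract m a) }.

(* Hom(A^{(x) n}, M) as the space of n-linear maps A^n -> M. *)
Section Multilinear.
Variables (k : fieldType) (A M : lmodType k) (n : nat).

Definition upd (a : 'I_n -> A) (i : 'I_n) (x : A) : 'I_n -> A :=
  fun j => if j == i then x else a j.

Definition multilinear (f : ('I_n -> A) -> M) : Prop :=
  forall a i, linear (fun x => f (upd a i x)).

Definition multilinearb : {pred ('I_n -> A) -> M} :=
  fun f => `[< multilinear f >].

Fact multilinear_submod : submod_closed multilinearb.
Proof.
split; first by apply/asboolP=> a i c x y /=; rewrite scaler0 addr0.
move=> c f g /asboolP fP /asboolP gP; apply/asboolP=> a i d x y.
rewrite -[LHS]/(c *: f _ + g _) fP gP -[X in _ = d *: X + _]/(c *: f _ + g _).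
rewrite -[X in _ = _ + X]/(c *: f _ + g _).
by rewrite !scalerDr !scalerA (mulrC d c) addrACA.
Qed.
HB.instance Definition _ := GRing.isSubmodClosed.Build k (('I_n -> A) -> M)
  multilinearb multilinear_submod.

Record multiHom := MultiHom {
  multi_fun :> ('I_n -> A) -> M;
  multi_funP : multi_fun \in multilinearb }.
HB.instance Definition _ := [isSub for multi_fun].
HB.instance Definition _ := [Choice of multiHom by <:].
HB.instance Definition _ := [SubChoice_isSubLmodule of multiHom by <:].

Lemma multiHom_linear (f : multiHom) : multilinear f.
Proof. by case: f => f /= /asboolP. Qed.

Definition mk_multi (f : ('I_n -> A) -> M) (fP : multilinear f) : multiHom :=
  MultiHom (asboolT fP).
End Multilinear.

(* The Hochschild differential of a product [op] on A with coefficients in M,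
   for left and right operations [l], [r] of A on M. *)
Section Hochschild.
Variables (k : fieldType) (A M : lmodType k).
Variables (op : {bilinear A -> A -> A}) (l : {bilinear A -> M -> M})
  (r : {bilinear M -> A -> M}).

(* (a_0, .., a_n) |-> (a_0, .., op a_i a_{i+1}, .., a_n): the entry i + 1 is
   left out, and then the entry i is replaced by the product. *)
Definition merge n (i : 'I_n) (a : 'I_n.+1 -> A) : 'I_n -> A :=
  upd (fun j => a (lift (lift ord0 i) j)) i
      (op (a (widen_ord (leqnSn n) i)) (a (lift ord0 i))).

(* Entries are numbered from 0, so the exponent n - i + 1 of the usual formula
   becomes n - i. *)
Definition hoch_fun n (f : ('I_n -> A) -> M) (a : 'I_n.+1 -> A) : M :=
  (-1) ^+ n.+1 *: l (a ord0) (f (fun j => a (lift ord0 j)))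
  + \sum_(i < n) (-1) ^+ (n - i) *: f (merge i a)
  + r (f (fun j => a (widen_ord (leqnSn n) j))) (a ord_max).

Lemma widen_lift n (i : 'I_n) : widen_ord (leqnSn n) i = lift ord_max i.
Proof. by apply/val_inj; rewrite [RHS]lift_max. Qed.

Lemma upd_lift n (a : 'I_n.+1 -> A) (h : 'I_n.+1) (i : 'I_n) x :
  (fun j => upd a (lift h i) x (lift h j)) = upd (fun j => a (lift h j)) i x.
Proof. by apply/funext=> j; rewrite /upd (inj_eq lift_inj). Qed.

Lemma upd_liftN n (a : 'I_n.+1 -> A) (h : 'I_n.+1) x :
  (fun j => upd a h x (lift h j)) = (fun j => a (lift h j)).
Proof. by apply/funext=> j; rewrite /upd eq_sym (negbTE (neq_lift _ _)). Qed.

Lemma updE n (a : 'I_n -> A) i x : upd a i x i = x.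
Proof. by rewrite /upd eqxx. Qed.

Lemma updN n (a : 'I_n -> A) i j x : j != i -> upd a i x j = a j.
Proof. by rewrite /upd => /negbTE->. Qed.

Lemma upd_upd n (a : 'I_n -> A) i x y : upd (upd a i x) i y = upd a i y.
Proof. by apply/funext=> j; rewrite /upd; case: eqP. Qed.

Lemma upd_swap n (a : 'I_n -> A) i j x y : i != j ->
  upd (upd a i x) j y = upd (upd a j y) i x.
Proof.
move=> ij; apply/funext=> h; rewrite /upd; case: (eqVneq h j) => // ->.
by rewrite eq_sym (negbTE ij).
Qed.

Fact merge_multilinear n (f : multiHom A M n) (i : 'I_n) :
  multilinear (fun a : 'I_n.+1 -> A => f (merge i a)).
Proof.
move=> a p c x y; have fP := multiHom_linear f.
have wl : widen_ord (leqnSn n) i = lift (lift ord0 i) i.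
  by apply/val_inj; rewrite /= /bump /= ltnn.
have wN : widen_ord (leqnSn n) i != lift ord0 i by rewrite wl eq_sym neq_lift.
rewrite /merge; case: (unliftP (lift ord0 i) p) => [j|] ->.
- rewrite !upd_lift (updN _ _ (neq_lift _ _)) !(updN _ _ (neq_lift _ _)) wl.
  have [<-|ji] := eqVneq j i.
    by rewrite !upd_upd !updE linearPl /= fP.
  by rewrite !updN ?(inj_eq lift_inj) 1?eq_sym // !(upd_swap _ _ _ ji) fP.
- by rewrite !upd_liftN !updE !(updN _ _ wN) linearPr fP.
Qed.

Fact lact_multilinear n (f : multiHom A M n) :
  multilinear (fun a : 'I_n.+1 -> A => l (a ord0) (f (fun j => a (lift ord0 j)))).
Proof.
move=> a p c x y; have fP := multiHom_linear f.
case: (unliftP ord0 p) => [j|] ->.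
- by rewrite !upd_lift !updN ?neq_lift // fP linearPr.
- by rewrite !upd_liftN !updE linearPl.
Qed.

Fact ract_multilinear n (f : multiHom A M n) :
  multilinear (fun a : 'I_n.+1 -> A =>
    r (f (fun j => a (widen_ord (leqnSn n) j))) (a ord_max)).
Proof.
have -> : (fun a : 'I_n.+1 -> A =>
    r (f (fun j => a (widen_ord (leqnSn n) j))) (a ord_max)) =
  (fun a => r (f (fun j => a (lift ord_max j))) (a ord_max)).
  apply/funext=> a; congr (r (f _) _).
  by apply/funext=> j; rewrite widen_lift.
move=> a p c x y; have fP := multiHom_linear f.
case: (unliftP ord_max p) => [j|] ->.
- by rewrite !upd_lift !updN ?neq_lift // fP linearPl.
- by rewrite !upd_liftN !updE linearPr.
Qed.

Fact hoch_multilinear n (f : multiHom A M n) : multilinear (hoch_fun f).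
Proof.
move=> a p c x y; rewrite /hoch_fun lact_multilinear ract_multilinear.
under eq_bigr do rewrite merge_multilinear scalerDr scalerA mulrC -scalerA.
rewrite big_split /= -scaler_sumr !scalerDr !scalerA (mulrC _ c).
by rewrite (addrACA (_ *: _)) (addrACA (_ + _)).
Qed.

Definition hoch n (f : multiHom A M n) : multiHom A M n.+1 :=
  mk_multi (hoch_multilinear f).

Fact hoch_linear n : linear (@hoch n).
Proof.
move=> c f g; apply/val_inj/funext=> a.
have E (b : 'I_n -> A) : (c *: f + g : multiHom A M n) b = c *: f b + g b by [].
rewrite -[RHS]/(c *: hoch_fun f a + hoch_fun g a).
rewrite -[LHS]/(hoch_fun (c *: f + g : multiHom A M n) a) /hoch_fun !E linearPr linearPl.
under eq_bigr do rewrite E scalerDr scalerA mulrC -scalerA.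
rewrite big_split /= -scaler_sumr !scalerDr !scalerA (mulrC _ c).
by rewrite (addrACA (_ *: _)) (addrACA (_ + _)).
Qed.
HB.instance Definition _ n := GRing.isLinear.Build k _ _ _ (@hoch n)
  (@hoch_linear n).
End Hochschild.

Section Complex.
Variables (k : fieldType) (lambda : k) (A : rbAlgebra lambda).
Variables (M : lmodType k) (TM : {linear M -> M}) (B : rbBimodule A TM).

Definition star (a b : A) : A :=
  rb_mul a (rb_op b) + rb_mul (rb_op a) b + lambda *: rb_mul a b.

Definition rtri (a : A) (m : M) : M := lact B (rb_op a) m - TM (lact B a m).

Definition ltri (m : M) (a : A) : M := ract B m (rb_op a) - TM (ract B m a).

Fact star_bilinear : bilinear_for *:%R *:%R star.
Proof.
by split=> u c x y; rewrite /star !(linearP, linearPl, linearPr) /= !scalerDr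
  (addrACA (c *: _)) (addrACA (_ + _)).
Qed.
HB.instance Definition _ :=
  bilinear_isBilinear.Build k A A A *:%R *:%R star star_bilinear.

Fact rtri_bilinear : bilinear_for *:%R *:%R rtri.
Proof.
by split=> u c x y; rewrite /rtri !(linearP, linearPl, linearPr) /=
  ?(linearP, linearPl, linearPr) /= scalerDr addrACA.
Qed.
HB.instance Definition _ :=
  bilinear_isBilinear.Build k A M M *:%R *:%R rtri rtri_bilinear.

Fact ltri_bilinear : bilinear_for *:%R *:%R ltri.
Proof.
by split=> u c x y; rewrite /ltri !(linearP, linearPl, linearPr) /=
  ?(linearP, linearPl, linearPr) /= scalerDr addrACA.
Qed.
HB.instance Definition _ :=
  bilinear_isBilinear.Build k M A M *:%R *:%R ltri ltri_bilinear.

Definition delta n : multiHom A M n -> multiHom A M n.+1 :=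
  @hoch k A M rb_mul (lact B) (ract B) n.
HB.instance Definition _ n := GRing.Linear.on (@delta n).

Definition partial n : multiHom A M n -> multiHom A M n.+1 :=
  @hoch k A M star rtri ltri n.
HB.instance Definition _ n := GRing.Linear.on (@partial n).

Definition op_on n (S : {set 'I_n}) (a : 'I_n -> A) : 'I_n -> A :=
  fun i => if i \in S then rb_op (a i) else a i.

(* The subset S stands for i_1 < .. < i_k. For n = 0 the sum is empty and this
   is the identity. *)
Definition Phi_fun n (f : ('I_n -> A) -> M) (a : 'I_n -> A) : M :=
  f (fun i => rb_op (a i))
  - \sum_(j < n) lambda ^+ (n - j - 1) *:
      \sum_(S : {set 'I_n} | #|S| == j) TM (f (op_on S a)).

Lemma op_on_upd n (S : {set 'I_n}) (a : 'I_n -> A) i x :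
  op_on S (upd a i x) = upd (op_on S a) i (if i \in S then rb_op x else x).
Proof.
by apply/funext=> j; rewrite /op_on /upd; case: (eqVneq j i) => [->|].
Qed.

Fact op_on_multilinear n (S : {set 'I_n}) (f : multiHom A M n) :
  multilinear (fun a : 'I_n -> A => f (op_on S a)).
Proof.
move=> a i c x y; rewrite !op_on_upd -(multiHom_linear f).
by case: ifP; rewrite // linearP.
Qed.

Lemma op_onT n (a : 'I_n -> A) : op_on [set: 'I_n] a = fun i => rb_op (a i).
Proof. by apply/funext=> i; rewrite /op_on inE. Qed.

Fact Phi_multilinear n (f : multiHom A M n) : multilinear (Phi_fun f).
Proof.
move=> a i c x y; rewrite /Phi_fun -!op_onT op_on_multilinear.
under eq_bigr => j _.
  under eq_bigr do rewrite op_on_multilinear linearP.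
  rewrite big_split /= -scaler_sumr scalerDr scalerA mulrC -scalerA; over.
by rewrite big_split /= -scaler_sumr scalerBr opprD addrACA.
Qed.

Definition Phi n (f : multiHom A M n) : multiHom A M n :=
  mk_multi (Phi_multilinear f).

Fact Phi_linear n : linear (@Phi n).
Proof.
move=> c f g; apply/val_inj/funext=> a.
have E (b : 'I_n -> A) : (c *: f + g : multiHom A M n) b = c *: f b + g b by [].
rewrite -[RHS]/(c *: Phi_fun f a + Phi_fun g a).
rewrite -[LHS]/(Phi_fun (c *: f + g : multiHom A M n) a) /Phi_fun !E.
under eq_bigr => j _.
  under eq_bigr do rewrite E linearP.
  rewrite big_split /= -scaler_sumr scalerDr scalerA mulrC -scalerA; over.
by rewrite big_split /= -scaler_sumr scalerBr opprD addrACA.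
Qed.
HB.instance Definition _ n := GRing.isLinear.Build k _ _ _ (@Phi n)
  (@Phi_linear n).

Definition cochain n : lmodType k :=
  if n is m.+1 then (multiHom A M n * multiHom A M m)%type : lmodType k
  else multiHom A M n.

(* In degree 0 there is no second component. *)
Definition diff n : cochain n -> cochain n.+1 :=
  match n with
  | 0 => fun f => (delta f, - Phi f)
  | m.+1 => fun fg => (delta fg.1, - partial fg.2 - Phi fg.1)
  end.

Fact diff_linear n : linear (@diff n).
Proof.
case: n => [|n] c x y; congr pair; rewrite /= !linearP //.
by rewrite scalerDr addrACA.
Qed.
HB.instance Definition _ n := GRing.isLinear.Build k _ _ _ (@diff n)
  (@diff_linear n).

Definition is_cocycle n : {pred cochain n} := fun c => diff c == 0.

Fact is_cocycle_submod n : submod_closed (@is_cocycle n).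
Proof.
split; first by rewrite /is_cocycle unfold_in linear0.
move=> a x y; rewrite !unfold_in => /eqP xP /eqP yP.
by rewrite /is_cocycle diff_linear xP yP scaler0 addr0.
Qed.
HB.instance Definition _ n := GRing.isSubmodClosed.Build k (cochain n)
  (@is_cocycle n) (@is_cocycle_submod n).

Record cocycle n := Cocycle {
  cocycle_val :> cochain n; cocycleP : cocycle_val \in @is_cocycle n }.
HB.instance Definition _ n := [isSub for @cocycle_val n].
HB.instance Definition _ n := [Choice of cocycle n by <:].
HB.instance Definition _ n := [SubChoice_isSubLmodule of cocycle n by <:].

Definition boundary n : cochain n -> Prop :=
  match n with
  | 0 => fun c => c = 0
  | m.+1 => fun c => exists b : cochain m, c = diff b
  end.

(* The coboundaries are taken among the cocycles, so that the quotient can be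
   formed without using that diff \o diff is 0. *)
Definition is_boundary n : {pred cocycle n} := fun z => `[< boundary z >].

Fact is_boundary_submod n : submod_closed (@is_boundary n).
Proof.
split; first by apply/asboolP; case: n => //= n; exists 0; rewrite linear0.
move=> a x y /asboolP xP /asboolP yP; apply/asboolP.
have : boundary (a *: cocycle_val x + cocycle_val y).
  case: n x y xP yP => [|n] [x ?] [y ?] /=; first by move=> -> ->; rewrite scaler0 addr0.
  by move=> [b ->] [c ->]; exists (a *: b + c); rewrite linearP.
by [].
Qed.
HB.instance Definition _ n := GRing.isSubmodClosed.Build k (cocycle n)
  (@is_boundary n) (@is_boundary_submod n).

Definition cohomology n := Quotient.quot (@is_boundary n).

Definition cohomology_class n (z : cocycle n) : cohomology n :=
  (\pi_(cohomology n) z)%qT.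
End Complex.

Record abelianExtension (k : fieldType) (lambda : k) (A : rbAlgebra lambda)
    (M : lmodType k) (TM : {linear M -> M}) := AbelianExtension {
  ext_alg :> rbAlgebra lambda;
  ext_i : rbHom (trivial_rb lambda TM) ext_alg;
  ext_p : rbHom ext_alg A;
  ext_inj : injective ext_i;
  ext_exact : forall x, ext_p x = 0 <-> exists m, ext_i m = x;
  ext_surj : forall a, exists x, ext_p x = a }.

Definition ext_isomorphic (k : fieldType) (lambda : k) (A : rbAlgebra lambda)
    (M : lmodType k) (TM : {linear M -> M}) (E1 E2 : abelianExtension A TM) :=
  exists zeta : rbHom E1 E2,
    [/\ bijective zeta,
        forall m, zeta (ext_i E1 m) = ext_i E2 m &
        forall x, ext_p E2 (zeta x) = ext_p E1 x].

Section Extension.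
Variables (k : fieldType) (lambda : k) (A : rbAlgebra lambda).
Variables (M : lmodType k) (TM : {linear M -> M}) (E : abelianExtension A TM).

Record extSection := ExtSection {
  section_fun :> {linear A -> E};
  section_funK : forall a, ext_p E (section_fun a) = a }.

(* The inverse of the inclusion of M, extended by 0 outside its image. *)
Definition ext_pull (x : E) : M := xget 0 [set m : M | ext_i E m = x].

Lemma ext_pullK (x : E) : ext_p E x = 0 -> ext_i E (ext_pull x) = x.
Proof. by move/ext_exact => [m mx]; rewrite /ext_pull; case: xgetP => // /(_ m). Qed.

Lemma ext_pi (m : M) : ext_p E (ext_i E m) = 0.
Proof. by apply/ext_exact; exists m. Qed.

Lemma ext_iM (m n : M) : rb_mul (ext_i E m) (ext_i E n) = 0.
Proof. by rewrite -rb_homM linear0. Qed.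

Lemma ext_iT (m : M) : rb_op (ext_i E m) = ext_i E (TM m).
Proof. by rewrite rb_homT. Qed.

Variable s : extSection.

Definition ind_l (a : A) (m : M) : M := ext_pull (rb_mul (s a) (ext_i E m)).
Definition ind_r (m : M) (a : A) : M := ext_pull (rb_mul (ext_i E m) (s a)).

Lemma ind_lK a m : ext_i E (ind_l a m) = rb_mul (s a) (ext_i E m).
Proof. by rewrite ext_pullK // rb_homM ext_pi linear0r. Qed.

Lemma ind_rK m a : ext_i E (ind_r m a) = rb_mul (ext_i E m) (s a).
Proof. by rewrite ext_pullK // rb_homM ext_pi linear0l. Qed.

Fact ind_l_bilinear : bilinear_for *:%R *:%R ind_l.
Proof.
by split=> u c x y; apply/(@ext_inj _ _ _ _ _ E); rewrite linearP !ind_lK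
  ?linearP ?linearPl ?linearPr.
Qed.
HB.instance Definition _ :=
  bilinear_isBilinear.Build k A M M *:%R *:%R ind_l ind_l_bilinear.

Fact ind_r_bilinear : bilinear_for *:%R *:%R ind_r.
Proof.
by split=> u c x y; apply/(@ext_inj _ _ _ _ _ E); rewrite linearP !ind_rK
  ?linearP ?linearPl ?linearPr.
Qed.
HB.instance Definition _ :=
  bilinear_isBilinear.Build k M A M *:%R *:%R ind_r ind_r_bilinear.

(* Lifts of an element of A act on M in the same way. *)
Lemma ind_lE (x : E) m : rb_mul x (ext_i E m) = ext_i E (ind_l (ext_p E x) m).
Proof.
rewrite ind_lK; apply/eqP; rewrite -subr_eq0 -linearBl /=.
have /ext_exact[n <-] : ext_p E (x - s (ext_p E x)) = 0.
  by rewrite linearB /= section_funK subrr.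
by rewrite ext_iM.
Qed.

Lemma ind_rE m (x : E) : rb_mul (ext_i E m) x = ext_i E (ind_r m (ext_p E x)).
Proof.
rewrite ind_rK; apply/eqP; rewrite -subr_eq0 -linearBr /=.
have /ext_exact[n <-] : ext_p E (x - s (ext_p E x)) = 0.
  by rewrite linearB /= section_funK subrr.
by rewrite ext_iM.
Qed.

Fact ind_lA a b m : ind_l (rb_mul a b) m = ind_l a (ind_l b m).
Proof.
apply/(@ext_inj _ _ _ _ _ E); rewrite (ind_lK a) (ind_lK b) rb_mulA ind_lE.
by rewrite rb_homM !section_funK.
Qed.

Fact ind_rA m a b : ind_r m (rb_mul a b) = ind_r (ind_r m a) b.
Proof.
apply/(@ext_inj _ _ _ _ _ E); rewrite (ind_rK _ b) (ind_rK _ a) -rb_mulA ind_rE.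
by rewrite rb_homM !section_funK.
Qed.

Fact ind_lrA a m b : ind_r (ind_l a m) b = ind_l a (ind_r m b).
Proof.
by apply/(@ext_inj _ _ _ _ _ E); rewrite ind_lK !ind_rK ind_lK rb_mulA.
Qed.

Fact ind_lT a m :
  ind_l (rb_op a) (TM m) =
  TM (ind_l a (TM m) + ind_l (rb_op a) m + lambda *: ind_l a m).
Proof.
apply/(@ext_inj _ _ _ _ _ E).
have -> : rb_op a = ext_p E (rb_op (s a)) by rewrite rb_homT section_funK.
rewrite -ind_lE -ext_iT rb_opM -[RHS]ext_iT; congr (rb_op _).
by rewrite [RHS]linearD [X in _ = X + _]linearD [X in _ = _ + X]linearZ /=
  -ind_lE !ind_lK !ext_iT.
Qed.

Fact ind_rT m a :
  ind_r (TM m) (rb_op a) =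
  TM (ind_r m (rb_op a) + ind_r (TM m) a + lambda *: ind_r m a).
Proof.
apply/(@ext_inj _ _ _ _ _ E).
have -> : rb_op a = ext_p E (rb_op (s a)) by rewrite rb_homT section_funK.
rewrite -ind_rE -ext_iT rb_opM -[RHS]ext_iT; congr (rb_op _).
by rewrite [RHS]linearD [X in _ = X + _]linearD [X in _ = _ + X]linearZ /=
  -ind_rE !ind_rK !ext_iT.
Qed.

Definition induced_bimodule : rbBimodule A TM :=
  @RBBimodule k lambda A M TM ind_l ind_r ind_lA ind_rA ind_lrA ind_lT ind_rT.

Definition induces (B : rbBimodule A TM) : Prop :=
  (forall a m, ext_i E (lact B a m) = rb_mul (s a) (ext_i E m)) /\
  (forall m a, ext_i E (ract B m a) = rb_mul (ext_i E m) (s a)).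

Lemma induced_bimoduleP : induces induced_bimodule.
Proof. by split; [exact: ind_lK|exact: ind_rK]. Qed.

(* ext_pull is applied to elements of the kernel of ext_p only. *)
Definition psi_fun (a : 'I_2 -> A) : M :=
  ext_pull (rb_mul (s (a ord0)) (s (a ord_max)) -
            s (rb_mul (a ord0) (a ord_max))).

Definition chi_fun (a : 'I_1 -> A) : M :=
  ext_pull (rb_op (s (a ord0)) - s (rb_op (a ord0))).

Lemma psi_funK a : ext_i E (psi_fun a) =
  rb_mul (s (a ord0)) (s (a ord_max)) - s (rb_mul (a ord0) (a ord_max)).
Proof. by rewrite ext_pullK // linearB /= rb_homM !section_funK subrr. Qed.

Lemma chi_funK a : ext_i E (chi_fun a) =
  rb_op (s (a ord0)) - s (rb_op (a ord0)).
Proof. by rewrite ext_pullK // linearB /= rb_homT !section_funK subrr. Qed.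

Fact psi_multilinear : multilinear psi_fun.
Proof.
move=> a i c x y; apply/(@ext_inj _ _ _ _ _ E); rewrite linearP !psi_funK /=.
have [-> | ->] : i = ord0 \/ i = ord_max.
  by case: i => [[|[|//]] ?]; [left|right]; exact/val_inj.
- by rewrite !updE !updN // !(linearP, linearPl) /= scalerDr addrACA.
- by rewrite !updE !updN // !(linearP, linearPr) /= scalerDr addrACA.
Qed.

Fact chi_multilinear : multilinear chi_fun.
Proof.
move=> a i c x y; apply/(@ext_inj _ _ _ _ _ E); rewrite linearP !chi_funK /=.
by rewrite ord1 !updE !linearP /= scalerDr addrACA.
Qed.

Definition psi : multiHom A M 2 := mk_multi psi_multilinear.
Definition chi : multiHom A M 1 := mk_multi chi_multilinear.

Fact telescope4 (V : zmodType) (p q r t : V) :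
  q - p + (r - t + (t - q)) + (p - r) = 0.
Proof.
by rewrite (addrA (r - t)) subrK (addrC (q - p)) !addrA !subrK subrr.
Qed.

Fact telescope11 (V : zmodType) (q r t u v w u1 v1 w1 u2 v2 h : V) :
  u + v + w - q - r + t = 0 ->
  - ((q - t - (u - u2)) - (u1 + v1 + w1 - h) + (r - t - (v - v2)))
   - (t - h - ((w - w1) + ((v2 - v1) + (u2 - u1)))) = 0.
Proof.
move=> e; rewrite -[RHS]e !(opprD, opprK) !addrA.
by rewrite [LHS](ACl (3*11*15*1*9*2*10*13*5*20*6*18*7*16*14*8*19*4*17*12)) /=
  !addrK.
Qed.

Lemma sum_card0 n (V : nmodType) (F : {set 'I_n} -> V) :
  \sum_(S : {set 'I_n} | #|S| == 0%N) F S = F finset.set0.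
Proof. by rewrite (big_pred1 finset.set0) // => S; rewrite cards_eq0. Qed.

Lemma sum_card1_ord2 (V : nmodType) (F : {set 'I_2} -> V) :
  \sum_(S : {set 'I_2} | #|S| == 1%N) F S = F [set ord0]%SET + F [set ord_max]%SET.
Proof.
rewrite (bigD1 [set ord0]%SET) ?cards1 //= (bigD1 [set ord_max]%SET) /=; last first.
  by rewrite cards1 /=; apply/eqP => /finset.setP/(_ ord0); rewrite !inE.
rewrite big1 ?addr0 // => S /andP[/andP[/cards1P[i ->]]].
have [->|->] : i = ord0 \/ i = ord_max.
  by case: i => [[|[|//]] ?]; [left|right]; exact/val_inj.
- by rewrite eqxx.
- by rewrite eqxx.
Qed.

Fact psi_chi_cocycle (B : rbBimodule A TM) : induces B ->
  ((psi, chi) : cochain A M 2) \in @is_cocycle k lambda A M TM B 2.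
Proof.
move=> [Bl Br]; apply/eqP; congr pair; apply/val_inj/funext=> a;
    apply/(@ext_inj _ _ _ _ _ E); rewrite [RHS]linear0.
  have -> : a = fun i => nth 0 [:: a ord0; a (lift ord0 ord0); a ord_max] i.
    apply/funext=> -[[|[|[|//]]] ?] /=; congr a; exact/val_inj.
  move: (a _) (a _) (a _) => x y z.
  rewrite -[LHS]/(ext_i E (hoch_fun _ _ _ psi _)) /hoch_fun.
  rewrite !big_ord_recl big_ord0 !linearD !linearZ /= Bl Br !psi_funK /merge /upd /=.
  rewrite !linearBr !linearBl /= !rb_mulA linear0 addr0.
  rewrite (_ : (2 - 0)%N = 2%N) // (_ : (2 - bump 0 0)%N = 1%N) //.
  rewrite -signr_odd sqrrN expr1n expr1 !scaleN1r scale1r !opprB.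
  exact: telescope4.
have -> : a = fun i => nth 0 [:: a ord0; a ord_max] i.
  by apply/funext=> -[[|[|//]] ?] /=; congr a; exact/val_inj.
move: (a _) (a _) => y x.
rewrite -[LHS]/(ext_i E (- hoch_fun _ _ _ chi _ - Phi_fun TM psi _)).
rewrite /hoch_fun /Phi_fun !big_ord_recl !big_ord0 sum_card0 sum_card1_ord2.
have iD u v : ext_i E (u + v) = ext_i E u + ext_i E v by exact: linearD.
have iN u : ext_i E (- u) = - ext_i E u by exact: linearN.
have iZ c u : ext_i E (c *: u) = c *: ext_i E u by exact: linearZ.
have i0 : ext_i E 0 = 0 by exact: linear0.
rewrite /rtri /ltri !(iD, iN, iZ, i0) -!ext_iT /= !Bl !Br.
rewrite !psi_funK !chi_funK /op_on /merge /upd /= !inE /=.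
rewrite (_ : (1 - 0)%N = 1%N) // (_ : (2 - 0 - 1)%N = 1%N) //.
rewrite (_ : (2 - bump 0 0 - 1)%N = 0%N) // !expr1 expr0 !scale1r scaleN1r.
rewrite sqrrN expr1n !scale1r !addr0.
have sS : rb_op (s (star x y)) = rb_op (s (rb_mul x (rb_op y))) +
    rb_op (s (rb_mul (rb_op x) y)) + lambda *: rb_op (s (rb_mul x y)).
  by rewrite /star 2!linearD linearZ 2!linearD linearZ.
have sh : s (rb_op (star x y)) = s (rb_mul (rb_op x) (rb_op y)) by rewrite rb_opM.
have oB (u v : E) : rb_op (u - v) = rb_op u - rb_op v by exact: linearB.
rewrite sS sh !linearBr !linearBl /= !oB scalerBr.
apply: telescope11.
have := ext_iM (chi_fun (fun=> x)) (chi_fun (fun=> y)).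
rewrite !chi_funK !linearBr !linearBl /= => <-.
rewrite rb_opM 2!linearD linearZ /= !opprB.
by rewrite -[LHS]addrA; congr (_ + _); rewrite [LHS]addrC.
Qed.

Definition ext_class (B : rbBimodule A TM) (h : induces B) : cohomology B 2 :=
  cohomology_class (Cocycle (psi_chi_cocycle h)).
End Extension.

(* Main.v *)
Require Import Defs.
From mathcomp Require Import all_boot all_order all_algebra.
From mathcomp Require Import boolp.
Set Implicit Arguments.
Unset Strict Implicit.
Unset Printing Implicit Defensive.
Import GRing.Theory.
Local Open Scope ring_scope.

(** Two choices enter the class of an extension: the extension within its
isomorphism class, and the section.

An isomorphism [zeta] from [E1] to [E2] removes the first choice without any
computation. If [s] is a section of [E1], then [zeta \o s] is a section of [E2].
Because [zeta] respects products and operators and fixes [M], the bimodule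
structures on [M] and the cochains psi and chi obtained from [s] and from
[zeta \o s] are the same, not merely cohomologous ([ext_class_transport]).

It remains to compare two sections [s] and [t] of one extension. Their
difference takes values in [M], hence is a cochain [f] of degree 1. As [M] has
zero product, [s] and [t] induce the same actions on it, and
  [s a * s b - t a * t b = s a * (s b - t b) + (s a - t a) * t b]
says that the two psi differ by the Hochschild coboundary of [f], the term
[- f (a b)] being the change of [s (a b)]. In the same way the two chi differ
by [TM (f a) - f (T a)], which is [- Phi f]. So the two cocycles differ by the
differential of [(f, 0)] ([psi_chi_section]), and their classes agree
([ext_class_section]). *)

Lemma subrACA (V : zmodType) (x y z w : V) :
  x - y - (z - w) = x - z - (y - w).
Proof. by rewrite !opprD addrACA. Qed.

Section Cohomologous.
Variables (k : fieldType) (lambda : k) (A : rbAlgebra lambda).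
Variables (M : lmodType k) (TM : {linear M -> M}) (B : rbBimodule A TM).

(** Restricted to positive degree: in degree 0 the coboundaries are not the
image of a differential. *)
Lemma cohomology_class_eq n (z w : cocycle B n.+1) (b : cochain A M n) :
  cocycle_val z - cocycle_val w = diff B b ->
  cohomology_class z = cohomology_class w.
Proof.
move=> zwb; apply/eqP; rewrite -Quotient.idealrBE.
by apply/asboolP; exists b.
Qed.

End Cohomologous.

Section ChangeOfSection.
Variables (k : fieldType) (lambda : k) (A : rbAlgebra lambda).
Variables (M : lmodType k) (TM : {linear M -> M}) (E : abelianExtension A TM).
Variables s t : extSection E.

(** Two lifts of an element of A differ by an element of M, which multiplies M
to zero. *)
Lemma induces_section (B : rbBimodule A TM) : induces s B -> induces t B.
Proof.
move=> [Bl Br]; split=> [a m|m a].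
- by rewrite Bl (ind_lE s (t a)) section_funK ind_lK.
- by rewrite Br (ind_rE s m (t a)) section_funK ind_rK.
Qed.

Definition section_diff (a : 'I_1 -> A) : M := ext_pull (s (a ord0) - t (a ord0)).

Lemma section_diffK a : ext_i E (section_diff a) = s (a ord0) - t (a ord0).
Proof. by rewrite ext_pullK // linearB /= !section_funK subrr. Qed.

Lemma section_diff_multilinear : multilinear section_diff.
Proof.
move=> a i c x y; apply/(@ext_inj _ _ _ _ _ E); rewrite linearP !section_diffK /=.
by rewrite ord1 !updE !linearP /= scalerDr addrACA.
Qed.

Definition section_cochain : multiHom A M 1 := mk_multi section_diff_multilinear.

(** The actions of A on M may be computed with either section. Taking [s] for the
left one and [t] for the right one makes [s a * s b - t a * t b] telescope. *)
Lemma psi_chi_section (B : rbBimodule A TM) : induces s B ->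
  ((psi s, chi s) : cochain A M 2) - ((psi t, chi t) : cochain A M 2) =
  diff B ((section_cochain, 0) : cochain A M 1).
Proof.
move=> sB; have [Bl _] := sB; have [_ Br] := induces_section sB.
have iD u v : ext_i E (u + v) = ext_i E u + ext_i E v by exact: linearD.
have iN u : ext_i E (- u) = - ext_i E u by exact: linearN.
rewrite /diff /= linear0 oppr0 add0r.
congr pair; apply/val_inj/funext=> a; apply/(@ext_inj _ _ _ _ _ E).
- rewrite -[LHS]/(ext_i E (psi_fun s a - psi_fun t a)) iD iN !psi_funK.
  rewrite -[RHS]/(ext_i E (hoch_fun _ _ _ section_cochain a)) /hoch_fun.
  rewrite !big_ord_recl big_ord0 addr0 expr1 scaleN1r sqrrN expr1n scale1r.
  rewrite !(iD, iN) Bl Br !section_diffK.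
  rewrite (_ : Defs.merge _ _ _ _ = rb_mul (a ord0) (a ord_max)); last first.
    by rewrite /Defs.merge updE; congr (rb_mul (a _) (a _)); apply/val_inj.
  rewrite (_ : lift ord0 ord0 = ord_max); last exact/val_inj.
  rewrite (_ : widen_ord _ ord0 = ord0); last exact/val_inj.
  by rewrite linearBr linearBl /= subrACA [RHS]addrAC subrKA.
- rewrite -[LHS]/(ext_i E (chi_fun s a - chi_fun t a)) iD iN !chi_funK.
  rewrite -[RHS]/(ext_i E (- Phi_fun TM section_cochain a)) /Phi_fun.
  rewrite !big_ord_recl big_ord0 addr0 sum_card0 expr0 scale1r.
  rewrite !(iD, iN) -ext_iT !section_diffK /op_on inE.
  by rewrite [RHS]opprB [rb_op (_ - _)]linearB subrACA.
Qed.

Lemma ext_class_section (B : rbBimodule A TM) (hs : induces s B)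
    (ht : induces t B) : ext_class hs = ext_class ht.
Proof.
apply: (@cohomology_class_eq _ _ _ _ _ _ 1).
exact: psi_chi_section hs.
Qed.

End ChangeOfSection.

Section Transport.
Variables (k : fieldType) (lambda : k) (A : rbAlgebra lambda).
Variables (M : lmodType k) (TM : {linear M -> M}) (E1 E2 : abelianExtension A TM).
Variable zeta : rbHom E1 E2.
Hypothesis zeta_i : forall m, zeta (ext_i E1 m) = ext_i E2 m.
Hypothesis zeta_p : forall x, ext_p E2 (zeta x) = ext_p E1 x.
Variable s : extSection E1.

Lemma transport_sectionK a : ext_p E2 ((zeta \o s) a) = a.
Proof. by rewrite /= zeta_p section_funK. Qed.

Definition transport_section : extSection E2 :=
  ExtSection transport_sectionK.

(** The bimodule has the same underlying maps for both extensions, since [zeta]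
fixes M; this is what makes the two classes elements of one cohomology space. *)
Lemma transport_induces (B : rbBimodule A TM) :
  induces s B -> induces transport_section B.
Proof. by move=> [Bl Br]; split=> *; rewrite -!zeta_i ?Bl ?Br rb_homM. Qed.

Lemma psi_transport : psi transport_section = psi s.
Proof.
apply/val_inj/funext=> a; apply/(@ext_inj _ _ _ _ _ E2).
by rewrite psi_funK -zeta_i psi_funK linearB /= rb_homM.
Qed.

Lemma chi_transport : chi transport_section = chi s.
Proof.
apply/val_inj/funext=> a; apply/(@ext_inj _ _ _ _ _ E2).
by rewrite chi_funK -zeta_i chi_funK linearB /= rb_homT.
Qed.

Lemma ext_class_transport (B : rbBimodule A TM) (h : induces s B)
    (h' : induces transport_section B) : ext_class h' = ext_class h.
Proof.
congr cohomology_class; apply: val_inj.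
by rewrite /= psi_transport chi_transport.
Qed.

End Transport.

Theorem proposition7p6 (k : fieldType) (char0 : [pchar k] =i pred0)
    (lambda : k) (A : rbAlgebra lambda) (M : lmodType k) (TM : {linear M -> M})
    (E1 E2 : abelianExtension A TM) (iso : ext_isomorphic E1 E2)
    (s1 : extSection E1) (s2 : extSection E2) :
  exists h2 : induces s2 (induced_bimodule s1),
    ext_class (induced_bimoduleP s1) = ext_class h2.
Proof.
have [zeta [_ zi zp]] := iso.
have ht := transport_induces zi zp (induced_bimoduleP s1).
exists (induces_section s2 ht).
by rewrite -(ext_class_transport zi _ ht); exact: ext_class_section.
Qed.
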